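(* Let $C[n,1]$ be an $(n,1,n)$ MRD code defined over $GF(2^n)$, where $n=2t+1$. Let $x=(x_1,x_2,\dots,x_n)$ be the transmitted codeword. Let $y=(y_1,y_2,\dots,y_n)$ be the received vector where $t$ coordinates are erasures. Let $*_1,*_2,\dots,*_t$ denote the $t$ erasures. The erasure $*_{s+1}$, where $s+1\le t$, can be chosen in $2^{\,n-t+s}[2^{\,t-s}-1]$ ways by using the guessing process. Then the various choices of the $*_j$'s do not affect the erasure correcting capability of the MRD code.
   Context: For $x=(x_1,\dots,x_n)\in GF(2^N)^n$, $n\le N$, the rank $r(x)$ is the rank over $GF(2)$ of the $N\times n$ matrix whose $i$-th column is the coordinate vector of $x_i$ with respect to a fixed basis of $GF(2^N)$ over $GF(2)$. The rank distance is $d_R(x,y)=r(x-y)$. An $(n,k,d)$ rank distance code over $GF(2^N)$ is a $k$-dimensional linear subspace of $GF(2^N)^n$ whose minimum distance $d$ is the minimum of $r(x)$ over its nonzero codewords; it is a Maximum Rank Distance (MRD) code if $d=n-k+1$. Here $N=n$ and $k=1$. An erasure is a coordinate of the received vector that is left blank (the demodulator gives no output there). Guessing process (filling up of the blank spaces): without loss of generality let the erasures $*_1,\dots,*_t$ be the first $t$ coordinates of $y$ and let $y_{t+1},\dots,y_n$ be the other coordinates. Choose $*_1\neq 0$ in $GF(2^n)$ such that $\{*_1,y_{t+1},\dots,y_n\}$ is linearly independent over $GF(2)$. Having chosen $*_1,\dots,*_s$ with $s<t$, choose $*_{s+1}\neq 0$ such that $\{*_{s+1},*_1,\dots,*_s,y_{t+1},\dots,y_n\}$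 is linearly independent over $GF(2)$. In this way the $t$ erasures are converted into (probable) errors, and the resulting vector is then decoded by the decoding algorithm for MRD codes with respect to the rank metric. The erasure correcting capability of the code refers to its ability to recover the transmitted codeword from a received vector with erasures by this procedure.
   Formalization: The number of choices for the next erasure is claimed only when the transmitted codeword x is nonzero; for x = 0 the unerased coordinates are all zero, so no choice is admissible and the stated formula fails. *)

(* Defs.v *)
From HB Require Import structures.
From mathcomp Require Import all_boot all_order all_algebra all_field.

Set Implicit Arguments.
Unset Strict Implicit.
Unset Printing Implicit Defensive.

Import GRing.Theory.
Local Open Scope ring_scope.

(* [L] is GF(2^N): a field extension of GF(2) of degree N.  [finvect_type L]
   is [L] itself, equipped with its (non-canonical) finite-type structure. *)

Section RankDistance.
Variables (L : fieldExtType 'F_2) (N n : nat) (b : N.-tuple L).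
Implicit Types (x y : 'rV[L]_n) (C : {vspace 'rV[L]_n}).

(* Meaningful when [b] is a basis of [L] over GF(2). *)
Definition rank_norm x : nat :=
  \rank (\matrix_(i < N, j < n) coord b i (x 0 j)).

Definition rank_dist x y : nat := rank_norm (x - y).

Definition min_rank_distance C (d : nat) : Prop :=
  (exists c, [/\ c \in C, c != 0 & rank_norm c = d]) /\
  (forall c, c \in C -> c != 0 -> (d <= rank_norm c)%N).

(* The length of the (n, k, d) code is the row length [n] in the type of C;
   [\dim C] is the dimension over [L]. *)
Definition rank_distance_code (k d : nat) C : Prop :=
  [/\ (n <= N)%N, \dim C = k & min_rank_distance C d].

Definition MRD_code (k d : nat) C : Prop :=
  rank_distance_code k d C /\ d = (n - k + 1)%N.

(* Bounded-distance decoding: the algorithm corrects up to (d-1)/2 rank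
   errors.  It returns the codeword within that rank distance of the input
   word if there is exactly one, and reports a failure otherwise. *)
Definition rank_decode C (d : nat) (z : 'rV[L]_n) : option 'rV[L]_n :=
  unset1 [set c : 'rV[finvect_type L]_n |
            (c \in C) && (rank_dist z c <= d.-1./2)%N].

End RankDistance.

Section Guessing.
Variables (L : fieldExtType 'F_2) (n : nat).
(* A received word; [None] is an erasure. *)
Implicit Types (y : 'I_n -> option L) (g : seq L).

Definition unerased y : seq L := pmap y (enum 'I_n).

(* [a] is an allowed next guess after the guesses [g].  Since [free] is about
   families, repeated elements are dependent. *)
Definition admissible_guess y g (a : L) : bool :=
  (a != 0) && free (a :: g ++ unerased y).

Inductive guess_run y : seq L -> Prop :=
| guess_run_nil : guess_run y [::]
| guess_run_rcons g a :
    guess_run y g -> admissible_guess y g a -> guess_run y (rcons g a).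

(* [e] lists the erased positions: the s-th guess goes to position e_s. *)
Definition fill y (e : seq 'I_n) g : 'rV[L]_n :=
  \row_(i < n) odflt (g`_(index i e)) (y i).

End Guessing.

(* Main.v *)
(** A nonzero word of an [(n, 1, n)] MRD code has full rank, that is, its
    coordinates are linearly independent over GF(2).  So an admissible guess
    after [s] earlier ones is exactly an element outside the span of [n - t + s]
    independent elements, and there are [2 ^ n - 2 ^ (n - t + s)] of these.
    Whatever the guesses, the filled-up word differs from the transmitted one in
    at most [t] coordinates, hence by a vector of rank at most [t = (n - 1) / 2],
    which is within the unique decoding radius. *)
Require Import Defs.
From mathcomp Require Import all_boot all_order all_algebra all_field.
Import GRing.Theory.
Local Open Scope ring_scope.

Section RankNorm.
Context {L : fieldExtType 'F_2} {N n : nat} (b : N.-tuple L).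
Implicit Types (x y z : 'rV[L]_n) (C : {vspace 'rV[L]_n}).

Lemma rank_normD x y :
  (rank_norm b (x + y) <= rank_norm b x + rank_norm b y)%N.
Proof.
rewrite /rank_norm; set A := (X in (_ <= \rank X + _)%N).
set B := (X in (_ <= _ + \rank X)%N).
suff -> : \matrix_(i, j) coord b i ((x + y) 0 j) = A + B by apply: mxrank_add.
by apply/matrixP=> i j; rewrite !mxE linearD.
Qed.

Lemma rank_normN x : rank_norm b (- x) = rank_norm b x.
Proof.
rewrite /rank_norm -mxrank_opp; congr (\rank _).
by apply/matrixP=> i j; rewrite !mxE linearN opprK.
Qed.

Lemma rank_dist_sym x y : rank_dist b x y = rank_dist b y x.
Proof. by rewrite /rank_dist -rank_normN opprB. Qed.

Lemma rank_dist_triangle z x y :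
  (rank_dist b x y <= rank_dist b x z + rank_dist b z y)%N.
Proof.
by rewrite /rank_dist -[x - y](subrKA z); apply: rank_normD.
Qed.

(** The columns at positions outside [e] vanish, so all columns of the coordinate matrix lie in the
    span of the [t] columns indexed by [e]. *)
Lemma rank_norm_support {t : nat} (e : t.-tuple 'I_n) x :
  (forall i, i \notin e -> x 0 i = 0) -> (rank_norm b x <= t)%N.
Proof.
move=> x0; rewrite /rank_norm; set M := \matrix_(i, j) _.
rewrite -mxrank_tr.
apply: leq_trans (rank_leq_row (rowsub (tnth e) M^T)).
apply/mxrankS/row_subP=> i; case: (boolP (i \in e)) => [/tnthP[k ->]|/x0 xi0].
  by rewrite -row_rowsub row_sub.
suff -> : row i M^T = 0 by apply: sub0mx.
by apply/rowP=> j; rewrite !mxE xi0 linear0.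
Qed.

(** Applying each [coord b j] to a GF(2)-relation among the coordinates turns it into a row vector
    killed by [M^T], which has independent rows. *)
Lemma free_of_full_rank x :
  rank_norm b x = n -> free [seq x 0 i | i <- enum 'I_n].
Proof.
rewrite /rank_norm; set M := \matrix_(i, j) _ => rkM.
apply/(@freeP _ _ _ (map_tuple (x 0) (ord_tuple n))) => k sum0.
have rfM : row_free M^T by rewrite /row_free mxrank_tr rkM.
suff /rowP k0 : \row_i k i = 0 by move=> i; have := k0 i; rewrite !mxE.
apply: (row_free_inj rfM); rewrite mul0mx; apply/rowP=> j; rewrite !mxE.
rewrite -[RHS](linear0 (coord b j)) -sum0 linear_sum.
apply: eq_bigr => i _; rewrite !mxE linearZ /=.
rewrite -[in RHS](tnth_nth 0 (map_tuple (x 0) (ord_tuple n))).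
by rewrite tnth_map tnth_ord_tuple.
Qed.

(** Two codewords within [d.-1./2] of [z] are at distance at most [d.-1] from each other, so they
    coincide; the decoding set is the singleton of [x]. *)
Lemma rank_decode_within C d x z :
    (0 < d)%N -> min_rank_distance b C d -> x \in C ->
  (rank_dist b z x <= d.-1./2)%N -> rank_decode b C d z = Some x.
Proof.
move=> d_gt0 [_ minC] xC zx; rewrite /rank_decode.
rewrite (_ : finset _ = [set (x : 'rV[finvect_type L]_n)]) ?set1K //.
apply/setP=> c; rewrite !inE; apply/idP/eqP=> [/andP[cC zc]|->]; last first.
  by rewrite xC.
apply/eqP; rewrite -subr_eq0; apply: contraLR (leqnn d) => cx0.
rewrite -ltnNge.
apply: leq_ltn_trans (minC _ (memvB cC xC) cx0) _.
rewrite -/(rank_dist b c x) -(prednK d_gt0) ltnS.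
apply: leq_trans (rank_dist_triangle z c x) _.
rewrite rank_dist_sym; apply: leq_trans (leq_add zc zx) _.
by rewrite addnn -[leqRHS](odd_double_half d.-1) leq_addl.
Qed.

End RankNorm.

Section Guessing.
Context {L : fieldExtType 'F_2} {n : nat} {y : 'I_n -> option L}.

(** The last admissibility check already covers the whole family, so a case analysis suffices, up to
    moving the last guess to the front. *)
Lemma guess_run_free g : free (unerased y) -> guess_run y g ->
  free (g ++ unerased y).
Proof.
move=> freeU; case=> // {}g a _ /andP[_]; rewrite cat_rcons.
by rewrite (perm_free (permEl (perm_catCA g [:: a] (unerased y)))).
Qed.

Lemma card_admissible_guess g : free (g ++ unerased y) ->
  #|[set a : finvect_type L | admissible_guess y g a]|
    = (2 ^ \dim {:L} - 2 ^ (size g + size (unerased y)))%N.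
Proof.
move=> freeGU; rewrite -size_cat -(eqP freeGU).
set V : {vspace finvect_type L} := <<g ++ unerased y>>%VS.
(* Prepending [a] to a free family keeps it free exactly when [a] avoids its span, which contains
   0. *)
have -> : [set a : finvect_type L | admissible_guess y g a] = ~: [set a in V].
  apply/setP=> a; rewrite !inE /admissible_guess free_cons freeGU andbT.
  by case: eqP => // ->; rewrite mem0v.
have card_fv (U : {vspace finvect_type L}) : #|U| = (2 ^ \dim U)%N.
  by rewrite card_vspace card_Fp.
have cardL : #|finvect_type L| = (2 ^ \dim {:L})%N.
  by rewrite -(card_fv fullv); apply: eq_card => a; rewrite memvf.
by rewrite cardsCs setCK cardsE card_fv cardL.
Qed.

Section Erasures.
Context {t : nat} {e : t.-tuple 'I_n} {x : 'rV[L]_n}.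
Hypothesis hy : forall i, y i = if i \in e then None else Some (x 0 i).

Lemma unerasedE : unerased y = [seq x 0 i | i <- enum 'I_n & i \notin e].
Proof.
rewrite /unerased; elim: (enum _) => //= i s ->.
by rewrite hy; case: (i \in e).
Qed.

Lemma size_unerased : uniq e -> size (unerased y) = (n - t)%N.
Proof.
move=> ue; have sz_e : count (mem e) (enum 'I_n) = t.
  rewrite -size_filter -[RHS](size_tuple e); apply: perm_size.
  apply: uniq_perm => //; first by rewrite filter_uniq ?enum_uniq.
  by move=> i; rewrite mem_filter mem_enum andbT.
rewrite unerasedE size_map size_filter.
by rewrite -[in RHS](size_enum_ord n) -(count_predC (mem e)) sz_e addKn.
Qed.

Lemma free_unerased : free [seq x 0 i | i <- enum 'I_n] -> free (unerased y).
Proof.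
(* List the erased coordinates first; the unerased ones are then a suffix of a free family. *)
have := perm_map (x 0) (permEl (perm_filterC (mem e) (enum 'I_n))).
by move/perm_free <-; rewrite map_cat unerasedE => /catr_free.
Qed.

(** Guesses enter only at positions of [e], so the support bound on the error is the same for every
    [g]. *)
Lemma fill_support g i : i \notin e -> (fill y e g - x) 0 i = 0.
Proof. by move=> /negbTE ie; rewrite !mxE hy ie subrr. Qed.

End Erasures.

End Guessing.

Theorem theorem3p3p3 (t n : nat) (hn : n = (2 * t + 1)%N)
  (L : fieldExtType 'F_2) (hL : \dim {:L} = n)
  (b : n.-tuple L) (hb : basis_of fullv b)
  (C : {vspace 'rV[L]_n}) (hC : MRD_code b 1 n C)
  (x : 'rV[L]_n) (hx : x \in C)
  (e : t.-tuple 'I_n) (he : uniq e)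
  (y : 'I_n -> option L)
  (hy : forall i, y i = if i \in e then None else Some (x 0 i)) :
  (x != 0 -> forall (s : nat) (g : seq L),
     (s < t)%N -> size g = s -> guess_run y g ->
     #|[set a : finvect_type L | admissible_guess y g a]|
       = (2 ^ (n - t + s) * (2 ^ (t - s) - 1))%N) /\
  (forall g : seq L, size g = t -> guess_run y g ->
     rank_decode b C n (fill y e g) = Some x).
Proof.
(* This makes the decoding radius [n.-1./2] exactly [t]. *)
have n1E : n.-1 = t.*2 by rewrite hn addn1 mul2n.
have [[_ _ minC] _] := hC; split=> [x0 s g lt_st sz_g run_g | g _ _].
  have rkx : rank_norm b x = n.
    by apply/eqP; rewrite eqn_leq rank_leq_col; apply: minC.2.
  have freeU := free_unerased hy (free_of_full_rank _ _ rkx).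
  rewrite card_admissible_guess; last exact: guess_run_free.
  (* The exponents [n - t + s] and [t - s] add up to [n], since [s < t <= n]. *)
  rewrite (size_unerased hy he) sz_g hL addnC mulnBr muln1 -expnD.
  rewrite -addnA subnKC 1?ltnW // subnK //.
  by rewrite hn mul2n -addnn -addnA leq_addr.
apply: rank_decode_within => //; first by rewrite hn addn1.
by rewrite n1E doubleK; apply: rank_norm_support (fill_support hy g).
Qed.
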